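(* Let $(K,\Psi)$ be a standard Borel space, $k\ge1$, and let $\mu$ be a strongly stationary probability measure on $(K^{[k]^\ast},\Psi^{\otimes[k]^\ast})$. Then for any $A_1,\dots,A_k\in\Psi$, \[\mu^{\mathrm{line}}(A_1\times A_2\times\cdots\times A_k)=0\ \Longrightarrow\ \mu^{\mathrm{pt}}(A_1\cap A_2\cap\cdots\cap A_k)=0.\]
   Context: $[k]^\ast=\bigcup_{N\ge1}[k]^N$. For $n\ge1$, an $n$-dimensional subspace is an injection $\phi:[k]^n\hookrightarrow[k]^\ast$ specified by integers $0=N_0<N_1<\dots<N_n$, nonempty sets $I_i\subseteq[N_i]\setminus[N_{i-1}]$ and a word $w\in[k]^{N_n}$, via $\phi(v_1\cdots v_n)_m=w_m$ for $m\notin I_1\cup\dots\cup I_n$ and $=v_i$ for $m\in I_i$. An infinite-dimensional subspace $\phi:[k]^\ast\hookrightarrow[k]^\ast$ is specified by an infinite sequence $0=N_0<N_1<\cdots$, nonempty $I_{i+1}\subseteq[N_{i+1}]\setminus[N_i]$ and words $w_i\in[k]^{N_i}$, where for $v\in[k]^n$, $\phi(v)\in[k]^{N_n}$ is given by the same formula with $w=w_n$. For such $\phi$ (finite or infinite dimensional, with domain $D$) define $T_\phi:K^{[k]^\ast}\to K^{D}$ by $(T_\phi\mathbf x)_u=x_{\phi(u)}$. A probability $\mu$ on $K^{[k]^\ast}$ is strongly stationary if $(T_\phi)_\#\mu=\mu$ for every infinite-dimensional subspace $\phi$. For such $\mu$, $(T_\phi)_\#\mu$ is the same for all $N$-dimensional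 subspaces $\phi$ and for all choices of a single word ($N=0$, i.e. the law of one coordinate $x_w$); the point marginal $\mu^{\mathrm{pt}}$ is the law on $K$ of any single coordinate $x_w$, and the line marginal $\mu^{\mathrm{line}}$ is the law on $K^k$ of $(x_{\phi(1)},\dots,x_{\phi(k)})$ for any combinatorial line ($1$-dimensional subspace) $\phi$. *)

(* Defs.v *)
From HB Require Import structures.
From mathcomp Require Import all_boot all_order all_algebra.
From mathcomp Require Import all_classical all_reals all_analysis.

Set Implicit Arguments.
Unset Strict Implicit.
Unset Printing Implicit Defensive.
Import Order.TTheory GRing.Theory Num.Theory.
Local Open Scope classical_set_scope.
Local Open Scope ring_scope.

(* Standard Borel space: measurably isomorphic to a Borel subset of the reals
   (Kuratowski's characterization). *)
Definition standard_borel d (K : measurableType d) (R : realType) : Prop :=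
  exists f : K -> R,
    [/\ injective f, measurable_fun setT f, measurable (range f)
      & forall A : set K, measurable A -> measurable (f @` A)].

(* [k]^* : nonempty words over the alphabet [k]; letters 1..k are encoded
   by 'I_k = {0..k-1}, positions 1..N by 0..N-1. *)
Definition word (k : nat) := {s : seq 'I_k | (0 < size s)%N}.

Definition KW (k : nat) (K : Type) := word k -> K.

Definition coord_sets d (K : measurableType d) (k : nat) : set (set (KW k K)) :=
  \bigcup_(w in [set: word k])
     preimage_set_system setT (fun x : KW k K => x w) measurable.

Definition prod_measurable d (K : measurableType d) (k : nat) :
  set (set (KW k K)) := <<s @coord_sets d K k >>.

Definition KW_display : measure_display -> measure_display.
Proof. exact. Qed.

Section KW_measurable.
Context {d} (K : measurableType d) (k : nat).

Let KW_set0 : @prod_measurable d K k set0.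
Proof. exact: sigma_algebra0. Qed.

Let KW_setC A : @prod_measurable d K k A -> @prod_measurable d K k (~` A).
Proof. exact: sigma_algebraC. Qed.

Let KW_bigcup (F : _^nat) : (forall i, @prod_measurable d K k (F i)) ->
  @prod_measurable d K k (\bigcup_i (F i)).
Proof. exact: sigma_algebra_bigcup. Qed.

HB.instance Definition _ := Pointed.on (KW k K).
HB.instance Definition _ := @isMeasurable.Build (KW_display d)
  (KW k K) (@prod_measurable d K k) KW_set0 KW_setC KW_bigcup.

End KW_measurable.

(* phi : [k]^* -> [k]^* is an infinite-dimensional subspace, given by
   0 = N_0 < N_1 < ..., nonempty I_{i+1} included in [N_{i+1}] \ [N_i]
   (0-indexed: {N_i, ..., N_{i+1}-1}), words w_n of length N_n, and
   phi(v)_m = v_i if m in I_i, = (w_n)_m otherwise, for v of length n. *)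
Definition is_inf_subspace (k : nat) (phi : word k -> word k) : Prop :=
  exists (N : nat -> nat) (I : nat -> set nat) (w : nat -> seq 'I_k),
  [/\ N 0 = 0%N,
      (forall i, (N i < N i.+1)%N),
      (forall i, I i.+1 `<=` [set m | (N i <= m < N i.+1)%N]),
      (forall i, I i.+1 !=set0)
    & (forall n, size (w n) = N n)] /\
    forall v : word k,
        let n := size (val v) in
        size (val (phi v)) = N n /\
        forall m, (m < N n)%N ->
          (forall i, (1 <= i <= n)%N -> I i m ->
             onth (val (phi v)) m = onth (val v) i.-1) /\
          ((forall i, (1 <= i <= n)%N -> ~ I i m) ->
             onth (val (phi v)) m = onth (w n) m).

(* p : [k] -> [k]^* lists the points phi(1), ..., phi(k) of a combinatorial
   line (1-dimensional subspace) phi. *)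
Definition is_line (k : nat) (p : 'I_k -> word k) : Prop :=
  exists (N1 : nat) (I : set nat) (w : seq 'I_k),
  [/\ (0 < N1)%N,
      I `<=` [set m | (m < N1)%N],
      I !=set0,
      size w = N1
    & forall a : 'I_k,
        size (val (p a)) = N1 /\
        forall m, (m < N1)%N ->
          (I m -> onth (val (p a)) m = Some a) /\
          (~ I m -> onth (val (p a)) m = onth w m)].

Definition Tphi (k : nat) (K : Type) (phi : word k -> word k) (x : KW k K) :
  KW k K := fun u => x (phi u).

Definition strongly_stationary d (K : measurableType d) (k : nat)
  (R : realType) (mu : probability (KW k K) R) : Prop :=
  forall phi : word k -> word k, is_inf_subspace phi ->
    forall E : set (KW k K), measurable E ->
      mu (Tphi phi @^-1` E) = mu E.

Definition line_marginal d (K : measurableType d) (k : nat) (R : realType)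
  (mu : probability (KW k K) R) (p : 'I_k -> word k) (A : 'I_k -> set K) :=
  mu [set x : KW k K | forall a : 'I_k, A a (x (p a))].

Definition point_marginal d (K : measurableType d) (k : nat) (R : realType)
  (mu : probability (KW k K) R) (w : word k) (B : set K) :=
  mu [set x : KW k K | B (x w)].

(* Main.v *)
Require Import Defs.
From HB Require Import structures.
From mathcomp Require Import all_boot all_order all_algebra.
From mathcomp Require Import all_classical all_reals all_analysis.
From mathcomp Require Import measurable_realfun ring lra.

Set Implicit Arguments.
Unset Strict Implicit.
Unset Printing Implicit Defensive.
Import Order.TTheory GRing.Theory Num.Theory.
Local Open Scope classical_set_scope.
Local Open Scope ring_scope.

(* If the point marginal gives mass [c > 0] to the intersection [B] of the
   [A_a], then on average a proportion [c] of the words [z] of length [n]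
   satisfies [x_z \in B]; if all lines are null, almost surely this random set
   of words contains no combinatorial line, against the density Hales-Jewett
   theorem.

   The latter is proved by induction on the alphabet, in the manner of Polymath
   and Dodos-Kanellopoulos-Tyros. Let [c] be the critical density for the
   alphabet [B + {None}], and [D] a set without lines of density close to [c];
   its density is at most about [c] on every large subspace. Since the theorem
   holds for [B], in a suitable subspace there is a set [C] of words of positive
   density, independent of the dimension, all of whose erasures ([None] replaced
   by a letter [b]) lie in [D]; [D] has no line, so it avoids [C]. But the
   complement of [C] is a disjoint union of intersections of sets that are
   insensitive to exchanging [None] with some [b], and such a set is almost a
   disjoint union of large subspaces. Hence [D] has density at most about
   [c (1 - dens C)], a contradiction. *)

(** * Averages *)

Section Averages.
Variable R : realType.

Definition avg (T : finType) (f : T -> R) : R := (\sum_t f t) / #|T|%:R.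

Lemma eq_avg (T : finType) (f g : T -> R) : f =1 g -> avg f = avg g.
Proof. by move=> fg; rewrite /avg (eq_bigr g). Qed.

Lemma avgD (T : finType) (f g : T -> R) :
  avg (fun t => f t + g t) = avg f + avg g.
Proof. by rewrite /avg big_split mulrDl. Qed.

Lemma avgMl (T : finType) (c : R) (f : T -> R) :
  avg (fun t => c * f t) = c * avg f.
Proof. by rewrite /avg -mulr_sumr mulrA. Qed.

Lemma avgB (T : finType) (f g : T -> R) :
  avg (fun t => f t - g t) = avg f - avg g.
Proof. by rewrite /avg sumrB mulrBl. Qed.

Lemma avg_cst (T : finType) (c : R) : (0 < #|T|)%N -> avg (fun _ : T => c) = c.
Proof.
by move=> T0; rewrite /avg sumr_const -[_ *+ _]mulr_natr mulfK// pnatr_eq0 -lt0n.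
Qed.

Lemma ler_avg (T : finType) (f g : T -> R) :
  (forall t, f t <= g t) -> avg f <= avg g.
Proof. by move=> fg; rewrite ler_wpM2r ?invr_ge0 ?ler0n// ler_sum. Qed.

Lemma avg_le (T : finType) (f : T -> R) (c : R) :
  (0 < #|T|)%N -> (forall t, f t <= c) -> avg f <= c.
Proof. by move=> T0 fc; rewrite -(avg_cst c T0); exact: ler_avg. Qed.

Lemma avg_ge (T : finType) (f : T -> R) (c : R) :
  (0 < #|T|)%N -> (forall t, c <= f t) -> c <= avg f.
Proof. by move=> T0 fc; rewrite -(avg_cst c T0); exact: ler_avg. Qed.

Lemma avg_reindex (T T' : finType) (h : T -> T') (f : T' -> R) :
  bijective h -> avg (fun t => f (h t)) = avg f.
Proof.
move=> bh; rewrite /avg (bij_eq_card bh); congr (_ / _).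
by rewrite [RHS](reindex h)//; exact: onW_bij.
Qed.

Lemma avg_pair (T1 T2 : finType) (f : T1 * T2 -> R) :
  avg f = avg (fun x => avg (fun y => f (x, y))).
Proof.
rewrite /avg -mulr_suml -mulrA card_prod natrM -invfM pair_bigA [in RHS]mulrC.
by rewrite mulrC [in RHS](mulrC #|T2|%:R); congr (_ * _); apply: eq_bigr => -[].
Qed.

Lemma avg_exchange (T1 T2 : finType) (f : T1 -> T2 -> R) :
  avg (fun x => avg (f x)) = avg (fun y => avg (fun x => f x y)).
Proof.
by rewrite /avg -!mulr_suml exchange_big /= -!mulrA [_^-1 * _]mulrC.
Qed.

Lemma avg_gt0P (T : finType) (D : T -> bool) :
  0 < avg (fun t => (D t)%:R) -> exists t, D t.
Proof.
move=> h; apply/existsP; apply: contraTT h => /existsPn h.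
by rewrite /avg big1 ?mul0r ?ltxx// => t _; rewrite (negbTE (h t)).
Qed.

Lemma avg_bool_le1 (T : finType) (D : T -> bool) : avg (fun t => (D t)%:R) <= 1.
Proof.
have [T0|] := posnP #|T|; first by rewrite /avg T0 invr0 mulr0.
by move=> T0; apply: avg_le => // t; case: (D t).
Qed.

Lemma avg_bool_ge0 (T : finType) (D : T -> bool) : 0 <= avg (fun t => (D t)%:R).
Proof. by rewrite /avg divr_ge0 ?ler0n// sumr_ge0// => t _; rewrite ler0n. Qed.

Lemma avg_image (T' T : finType) (e : T' -> T) (h : T -> R) :
  injective e ->
  avg (fun t => (t \in codom e)%:R * h t)
    = #|T'|%:R / #|T|%:R * avg (fun t' => h (e t')).
Proof.
move=> inje; have [T'0|T'0] := posnP #|T'|.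
  rewrite T'0 !mul0r /avg big1 ?mul0r// => t _.
  case: codomP => [[t' _]|_]; last by rewrite mul0r.
  by have := card0_eq T'0 t'; rewrite inE.
rewrite /avg mulrACA [#|T'|%:R * _]mulrC mulrACA mulfV ?mulr1 ?pnatr_eq0 -?lt0n//.
congr (_ / _).
rewrite (bigID (mem (codom e))) /= [X in _ + X]big1 ?addr0; last first.
  by move=> t /negbTE ->; rewrite mul0r.
transitivity (\sum_(t in codom e) h t).
  by apply: eq_bigr => t ->; rewrite mul1r.
by rewrite -big_uniq ?big_image//= map_inj_uniq// enum_uniq.
Qed.

(** The deficits [a - f t] are nonnegative and sum to at most [#|T|%:R * e], so no single one
    exceeds that total. *)
Lemma avg_near_max (T : finType) (f : T -> R) (a e : R) (t0 : T) :
  (forall t, f t <= a) -> a - e <= avg f -> a - #|T|%:R * e <= f t0.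
Proof.
move=> fa; have T0 : (0 < #|T|)%N by apply/card_gt0P; exists t0.
rewrite lerBlDr -lerBlDl => h; rewrite lerBlDr -lerBlDl.
apply: le_trans (_ : #|T|%:R * (a - avg f) <= _); last first.
  by rewrite ler_wpM2l// lerBlDr -lerBlDl.
rewrite -[X in _ <= _ * (X - _)](avg_cst a T0) -avgB mulrC divfK; last first.
  by rewrite pnatr_eq0 -lt0n.
rewrite (bigD1 t0)//= lerDl sumr_ge0// => t _; by rewrite subr_ge0.
Qed.

(** Pointwise [p <= c / 2 + \sum_t Q t], so the densities of the [Q t] add up to at least [c / 2];
    asking only for [c / 4] leaves room for a strict contradiction. *)
Lemma avg_pigeonhole (Z T : finType) (p : Z -> R) (Q : T -> Z -> bool) (c : R) :
  (0 < #|Z|)%N -> 0 < c -> (forall z, p z <= 1) -> c <= avg p ->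
  (forall z, c / 2 <= p z -> exists t, Q t z) ->
  exists t, c / 4 / #|T|%:R <= avg (fun z => (Q t z)%:R).
Proof.
move=> Z0 c0 p1 cp pQ; apply: contrapT => /forallNP h.
have : avg p <= avg (fun z => c / 2 + \sum_t (Q t z)%:R).
  apply: ler_avg => z; have [/pQ[t Qt]|/ltW pz] := leP (c / 2) (p z).
    rewrite (bigD1 t)//= Qt addrA (le_trans (p1 z))// -addrA addrCA lerDl.
    by rewrite addr_ge0 ?sumr_ge0//; lra.
  by rewrite (le_trans pz)// lerDl sumr_ge0.
rewrite avgD avg_cst//.
have -> : avg (fun z => \sum_t (Q t z)%:R) = \sum_t avg (fun z => (Q t z)%:R).
  by rewrite /avg exchange_big /= mulr_suml.
have : \sum_(t : T) avg (fun z => (Q t z)%:R) <= \sum_(t : T) c / 4 / #|T|%:R.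
  by apply: ler_sum => t _; apply/ltW; rewrite ltNge; apply/negP/h.
rewrite sumr_const -[_ *+ _]mulr_natr.
have : c / 4 / #|T|%:R * #|T|%:R <= c / 4.
  have [->|T0] := posnP #|T|; first by rewrite mulr0; lra.
  by rewrite divfK// pnatr_eq0 -lt0n.
lra.
Qed.

Lemma expr_small (a e : R) : 0 <= a < 1 -> 0 < e -> exists r, a ^+ r <= e.
Proof.
move=> /andP[a0 a1] e0.
(* A variant of Bernoulli's inequality, without division by [a], which may vanish. *)
have ber r : a ^+ r * (1 + r%:R * (1 - a)) <= 1.
  elim: r => [|r IH]; first by rewrite expr0 mul0r addr0 mulr1.
  apply: le_trans IH; rewrite exprSr -mulrA ler_wpM2l ?exprn_ge0//.
  rewrite -natr1; have := ler0n R r; set x : R := r%:R => x0.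
  suff : 0 <= (x + 1) * ((1 - a) * (1 - a)) by nra.
  by rewrite mulr_ge0 ?addr_ge0// mulr_ge0; lra.
exists (Num.bound (e^-1 / (1 - a))).
set r := Num.bound _.
have hr : e^-1 <= r%:R * (1 - a).
  rewrite -ler_pdivrMr; last by lra.
  by rewrite ltW// archi_boundP// divr_ge0 ?invr_ge0; lra.
rewrite -[leLHS]mulr1 -(mulfV (lt0r_neq0 e0)) mulrCA.
rewrite -[leRHS]mulr1 (ler_wpM2l (ltW e0))//; apply: le_trans (ber r).
rewrite ler_wpM2l ?exprn_ge0//; lra.
Qed.

End Averages.

(** * Words and combinatorial subspaces *)

Section Words.
Variable A : finType.
Implicit Types X Y Z : finType.

(** Words are indexed by arbitrary finite types: blocks of coordinates are summands and bijections
    re-index, without arithmetic on positions. *)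
Definition cat_word X1 X2 (x : {ffun X1 -> A}) (y : {ffun X2 -> A}) :
    {ffun X1 + X2 -> A} :=
  [ffun t => match t with inl t => x t | inr t => y t end].

Definition ren_word X X' (h : X -> X') (x : {ffun X' -> A}) : {ffun X -> A} :=
  [ffun t => x (h t)].

Definition cons_word X X' (h : X -> option X') (a : A) (x : {ffun X' -> A}) :
    {ffun X -> A} :=
  [ffun t => if h t is Some t' then x t' else a].

(* A map [u : X -> A + Y] describes a combinatorial subspace of [A^X] with
   wildcards indexed by [Y], provided that every wildcard occurs. *)
Definition fill X Y (u : {ffun X -> A + Y}) (x : {ffun Y -> A}) :
    {ffun X -> A} :=
  [ffun t => match u t with inl a => a | inr y => x y end].

Definition onto X Y (u : {ffun X -> A + Y}) := forall y, exists t, u t = inr y.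

Definition comp_pat X Y Z (u : {ffun X -> A + Y}) (w : {ffun Y -> A + Z}) :
    {ffun X -> A + Z} :=
  [ffun t => match u t with inl a => inl a | inr y => w y end].

Definition ren_pat X X' Y (h : X -> X') (u : {ffun X' -> A + Y}) :
    {ffun X -> A + Y} := [ffun t => u (h t)].

Definition catl_pat X1 X2 Y (u : {ffun X1 -> A + Y}) (y : {ffun X2 -> A}) :
    {ffun X1 + X2 -> A + Y} :=
  [ffun t => match t with inl t => u t | inr t => inl (y t) end].

Definition catr_pat X1 X2 Y (x : {ffun X1 -> A}) (u : {ffun X2 -> A + Y}) :
    {ffun X1 + X2 -> A + Y} :=
  [ffun t => match t with inl t => inl (x t) | inr t => u t end].

Definition id_pat Y : {ffun Y -> A + Y} := [ffun y => inr y].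

Lemma fill_comp X Y Z (u : {ffun X -> A + Y}) (w : {ffun Y -> A + Z}) x :
  fill (comp_pat u w) x = fill u (fill w x).
Proof. by apply/ffunP => t; rewrite !ffunE; case: (u t) => // y; rewrite ffunE. Qed.

Lemma onto_comp X Y Z (u : {ffun X -> A + Y}) (w : {ffun Y -> A + Z}) :
  onto u -> onto w -> onto (comp_pat u w).
Proof.
move=> ou ow z; have [y wy] := ow z; have [t ut] := ou y.
by exists t; rewrite ffunE ut.
Qed.

Lemma fill_ren X X' Y (h : X -> X') (u : {ffun X' -> A + Y}) x :
  fill (ren_pat h u) x = ren_word h (fill u x).
Proof. by apply/ffunP => t; rewrite !ffunE. Qed.

Lemma onto_ren X X' Y (h : X -> X') (u : {ffun X' -> A + Y}) :
  bijective h -> onto u -> onto (ren_pat h u).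
Proof.
by move=> [g _ gK] ou y; have [t ut] := ou y; exists (g t); rewrite ffunE gK.
Qed.

Lemma fill_catl X1 X2 Y (u : {ffun X1 -> A + Y}) (y : {ffun X2 -> A}) x :
  fill (catl_pat u y) x = cat_word (fill u x) y.
Proof. by apply/ffunP => -[t|t]; rewrite !ffunE. Qed.

Lemma onto_catl X1 X2 Y (u : {ffun X1 -> A + Y}) (y : {ffun X2 -> A}) :
  onto u -> onto (catl_pat u y).
Proof. by move=> ou z; have [t ut] := ou z; exists (inl t); rewrite ffunE. Qed.

Lemma fill_catr X1 X2 Y (z : {ffun X1 -> A}) (u : {ffun X2 -> A + Y}) x :
  fill (catr_pat z u) x = cat_word z (fill u x).
Proof. by apply/ffunP => -[t|t]; rewrite !ffunE. Qed.

Lemma onto_catr X1 X2 Y (z : {ffun X1 -> A}) (u : {ffun X2 -> A + Y}) :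
  onto u -> onto (catr_pat z u).
Proof. by move=> ou y; have [t ut] := ou y; exists (inr t); rewrite ffunE. Qed.

Lemma fill_id Y (x : {ffun Y -> A}) : fill (id_pat Y) x = x.
Proof. by apply/ffunP => t; rewrite !ffunE. Qed.

Lemma onto_id Y : onto (id_pat Y).
Proof. by move=> y; exists y; rewrite ffunE. Qed.

Lemma fill_inj X Y (u : {ffun X -> A + Y}) : onto u -> injective (fill u).
Proof.
move=> ou x x' /ffunP xx'; apply/ffunP => y; have [t ut] := ou y.
by have := xx' t; rewrite !ffunE ut.
Qed.

Lemma card_word_gt0 X : (0 < #|A|)%N -> (0 < #|{ffun X -> A}|)%N.
Proof. by move=> A0; rewrite card_ffun expn_gt0 A0. Qed.

Variable R : realType.

Lemma avg_ren X X' (h : X -> X') (f : {ffun X -> A} -> R) :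
  bijective h -> avg (fun x => f (ren_word h x)) = avg f.
Proof.
move=> [g hK gK]; apply: (avg_reindex f); exists (ren_word g) => x;
  by apply/ffunP => t; rewrite !ffunE (hK, gK).
Qed.

Lemma avg_cat X1 X2 (f : {ffun X1 + X2 -> A} -> R) :
  avg f = avg (fun x => avg (fun y => f (cat_word x y))).
Proof.
rewrite -(@avg_pair R {ffun X1 -> A} {ffun X2 -> A}
  (fun p => f (cat_word p.1 p.2))).
symmetry; apply: (@avg_reindex R _ _ (fun p => cat_word p.1 p.2) f).
exists (fun z : {ffun X1 + X2 -> A} => ([ffun t => z (inl t)], [ffun t => z (inr t)])).
  by move=> [x y] /=; congr pair; apply/ffunP => t; rewrite !ffunE.
by move=> z; apply/ffunP => -[t|t]; rewrite !ffunE.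
Qed.

Lemma avg_catC X1 X2 (f : {ffun X1 + X2 -> A} -> R) :
  avg f = avg (fun y => avg (fun x => f (cat_word x y))).
Proof. by rewrite avg_cat avg_exchange. Qed.

Lemma avg_cons X X' (h : X -> option X') (f : {ffun X -> A} -> R) :
  bijective h -> avg f = avg (fun a => avg (fun x => f (cons_word h a x))).
Proof.
move=> [g hK gK].
rewrite -(@avg_pair R A {ffun X' -> A} (fun p => f (cons_word h p.1 p.2))).
symmetry; apply: (@avg_reindex R _ _ (fun p => cons_word h p.1 p.2) f).
exists (fun z : {ffun X -> A} => (z (g None), [ffun t => z (g (Some t))])).
  move=> [a x] /=; congr pair; first by rewrite ffunE gK.
  by apply/ffunP => t; rewrite !ffunE gK.
move=> z; apply/ffunP => t; rewrite ffunE /=; rewrite -[in RHS](hK t).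
by case: (h t) => // t'; rewrite ffunE.
Qed.

End Words.

Lemma split_index (X Z : finType) : (#|Z| <= #|X|)%N ->
  exists n (h : X -> Z + 'I_n), n = (#|X| - #|Z|)%N /\ bijective h.
Proof.
move=> ZX; exists (#|X| - #|Z|)%N.
have e : #|X| = #|{: Z + 'I_(#|X| - #|Z|)}| by rewrite card_sum card_ord subnKC.
exists (fun t => enum_val (cast_ord e (enum_rank t))); split => //.
exists (fun t => enum_val (cast_ord (esym e) (enum_rank t))) => t.
  by rewrite enum_valK cast_ordK enum_rankK.
by rewrite enum_valK cast_ordKV enum_rankK.
Qed.

Lemma option_index (X : finType) n : #|X| = n.+1 ->
  exists h : X -> option 'I_n, bijective h.
Proof.
move=> Xn; have e : #|X| = #|{: option 'I_n}| by rewrite card_option card_ord.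
exists (fun t => enum_val (cast_ord e (enum_rank t))).
exists (fun t => enum_val (cast_ord (esym e) (enum_rank t))) => t.
  by rewrite enum_valK cast_ordK enum_rankK.
by rewrite enum_valK cast_ordKV enum_rankK.
Qed.

Lemma unlift0_bij n : bijective (@unlift n.+1 ord0).
Proof.
exists (fun o => if o is Some i then lift ord0 i else ord0).
  by move=> i; case: unliftP => [j|] ->.
by case=> [i|]; rewrite ?liftK ?unlift_none.
Qed.

(** * Densities on subspaces over a smaller alphabet *)

Section Subcube.
Variables (R : realType) (A S : finType) (tau : A -> S).
Hypotheses (A0 : (0 < #|A|)%N) (tau_inj : injective tau).

Let q : R := #|A|%:R / #|S|%:R.

Let S0 : (0 < #|S|)%N.
Proof. by rewrite (leq_trans A0)// (leq_card tau). Qed.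

Lemma subcube_ratio : 0 < q <= 1.
Proof.
rewrite divr_gt0 ?ltr0n//= ler_pdivrMr ?ltr0n// mul1r ler_nat.
exact: leq_card tau_inj.
Qed.

Definition map_word (X : finType) (x : {ffun X -> A}) : {ffun X -> S} :=
  [ffun t => tau (x t)].

(* Exposing the coordinates one at a time, a coordinate whose letter lies in
   the image of [tau] becomes a uniformly distributed free coordinate; the
   second term bounds the probability that fewer than [j] of them occur. *)
Lemma avg_le_subcubes n j (X : finType) (f : {ffun X -> S} -> R) (beta : R) :
  #|X| = n -> (forall x, f x <= 1) -> 0 <= beta ->
  (forall g : {ffun X -> S + 'I_j}, onto g ->
    avg (fun x => f (fill g (map_word x))) <= beta) ->
  avg f <= beta + 2 ^+ j * (1 - q / 2) ^+ n.
Proof.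
have /andP[q0 q1] := subcube_ratio.
have r0 : 0 <= 1 - q / 2 by lra.
(* With [j = 0] the patterns are constant, so the hypothesis bounds [f] at every word. *)
have base0 (Y : finType) (f' : {ffun Y -> S} -> R) i : 0 <= beta ->
    (forall g : {ffun Y -> S + 'I_0}, onto g ->
      avg (fun x => f' (fill g (map_word x))) <= beta) ->
    avg f' <= beta + 2 ^+ 0 * (1 - q / 2) ^+ i.
  move=> b0 fb; rewrite (le_trans _ (_ : beta <= _)) ?lerDl ?mulr_ge0 ?exprn_ge0//.
  apply: avg_le; first exact: card_word_gt0.
  move=> x; apply: le_trans (fb [ffun t => inl (x t)] _); last by case.
  rewrite (@eq_avg _ _ _ (fun=> f' x)) ?avg_cst//; first exact: card_word_gt0.
  by move=> y; congr f'; apply/ffunP => t; rewrite !ffunE.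
elim: n j X f => [|n IH] [|j] X f Xn f1 b0 fb.
- exact: base0.
- apply: (@le_trans _ _ 1); first by apply: avg_le => //; exact: card_word_gt0.
  rewrite expr0 mulr1 -[leLHS]add0r lerD// exprn_ege1//; lra.
- exact: base0.
have [h bh] := option_index Xn.
rewrite (avg_cons f bh).
set F := fun s => avg (fun x => f (cons_word h s x)).
have Fs s : F s <= beta + 2 ^+ j.+1 * (1 - q / 2) ^+ n.
  apply: IH => //; first by rewrite card_ord.
  move=> g og.
  apply: le_trans (fb [ffun t => if h t is Some t' then g t' else inl s] _).
    apply: ler_avg => x; rewrite le_eqVlt; apply/orP; left; apply/eqP.
    congr f; apply/ffunP => t; rewrite !ffunE.
    by case: (h t) => // t'; rewrite !ffunE.
  case: bh => h' hK h'K y; have [t gt] := og y; exists (h' (Some t)).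
  by rewrite ffunE h'K.
(* Averaged over the image of [tau], the exposed coordinate becomes the wildcard [ord0], so [j] more
   suffice. *)
have Fa : avg (fun a => F (tau a)) <= beta + 2 ^+ j * (1 - q / 2) ^+ n.
  rewrite avg_exchange; apply: IH => //; first by rewrite card_ord.
    by move=> x; apply: avg_le.
  move=> g og; rewrite avg_exchange.
  apply: le_trans (fb [ffun t => if h t is Some t'
    then match g t' with inl s => inl s | inr i => inr (lift ord0 i) end
    else inr ord0] _).
    rewrite [leRHS](avg_cons _ (@unlift0_bij j)).
    apply: ler_avg => a; apply: ler_avg => x.
    rewrite le_eqVlt; apply/orP; left; apply/eqP.
    congr f; apply/ffunP => t; rewrite !ffunE.
    case: (h t) => [t'|]; last by rewrite !ffunE unlift_none.
    by rewrite !ffunE; case: (g t') => // i; rewrite !ffunE liftK.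
  case: bh => h' hK h'K y; case: (unliftP ord0 y) => [i ->|->].
    by have [t gt] := og i; exists (h' (Some t)); rewrite ffunE h'K gt.
  by exists (h' None); rewrite ffunE h'K.
have -> : avg F = q * avg (fun a => F (tau a))
    + avg (fun s => (s \notin codom tau)%:R * F s).
  rewrite -avg_image// -avgD; apply: eq_avg => s.
  by case: (s \in _); rewrite !(mul1r, mul0r, add0r, addr0).
set w := (1 - q / 2) ^+ n in Fs Fa *.
have le2 : avg (fun s => (s \notin codom tau)%:R * F s)
    <= (1 - q) * (beta + 2 ^+ j.+1 * w).
  apply: (@le_trans _ _ (avg (fun s : S => (beta + 2 ^+ j.+1 * w)
      * (1 - (s \in codom tau)%:R * 1)))).
    apply: ler_avg => s; case: (s \in _); last by rewrite mul0r subr0 mul1r mulr1.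
    by rewrite mul0r mulr1 subrr mulr0.
  by rewrite avgMl avgB avg_image// !avg_cst// mulr1 mulrC.
(* The rate arises here: [q / 2 + (1 - q) = 1 - q / 2], the half being the ratio of [2 ^+ j] to
   [2 ^+ j.+1]. *)
apply: le_trans (lerD (ler_wpM2l (ltW q0) Fa) le2) _.
rewrite !exprS -/w; set P := 2 ^+ j; nra.
Qed.

End Subcube.

(** * Density Hales-Jewett *)

Section Lines.
Variable A : finType.
Implicit Types X Y : finType.

Definition line_pt X (v : {ffun X -> option A}) (a : A) : {ffun X -> A} :=
  [ffun t => odflt a (v t)].

Definition has_line X (D : {ffun X -> A} -> bool) :=
  exists v : {ffun X -> option A},
    (exists t, v t = None) /\ forall a, D (line_pt v a).

Lemma has_line_fill X Y (u : {ffun X -> A + Y}) (D : {ffun X -> A} -> bool) :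
  onto u -> has_line (fun x => D (fill u x)) -> has_line D.
Proof.
move=> ou [v [[y vy] vD]].
exists [ffun t => match u t with inl a => Some a | inr y => v y end]; split.
  by have [t ut] := ou y; exists t; rewrite ffunE ut.
move=> a; rewrite (_ : line_pt _ a = fill u (line_pt v a))//.
by apply/ffunP => t; rewrite !ffunE; case: (u t) => // z; rewrite ffunE.
Qed.

Variable R : realType.

Definition dhj (c : R) := exists n, forall X : finType, (n <= #|X|)%N ->
  forall D : {ffun X -> A} -> bool,
    c <= avg (fun x => (D x)%:R) -> has_line D.

Definition mdhj (m : nat) (c : R) := exists n, forall X : finType,
  (n <= #|X|)%N -> forall D : {ffun X -> A} -> bool,
    c <= avg (fun x => (D x)%:R) ->
    exists2 u : {ffun X -> A + 'I_m}, onto u & forall x, D (fill u x).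

(** Split off a block of [n1] coordinates. Many tails [y] have a section containing a line; as there
    are finitely many lines, one line [v] works for a dense set of tails, in which induction finds
    the other [m] wildcards. *)
Lemma dhj_mdhj m (c : R) : (0 < #|A|)%N -> (forall c, 0 < c -> dhj c) ->
  0 < c -> mdhj m c.
Proof.
move=> A0 H; elim: m c => [|m IH] c c0.
  exists 0%N => X _ D cD; have [x Dx] := avg_gt0P (lt_le_trans c0 cD).
  exists [ffun t => inl (x t)]; first by case.
  by move=> y; rewrite (_ : fill _ _ = x)//; apply/ffunP => t; rewrite !ffunE.
have [n1 Hn1] := H (c / 2) ltac:(lra).
pose T := {ffun 'I_n1 -> option A}.
have T0 : (0 < #|T|)%N by apply: card_word_gt0; rewrite card_option.
have [n2 Hn2] := IH (c / 4 / #|T|%:R) ltac:(by rewrite !divr_gt0// ltr0n).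
exists (n1 + n2)%N => X Xn D cD.
have /split_index [n [h [nE bh]]] : (#|'I_n1| <= #|X|)%N.
  by rewrite card_ord (leq_trans (leq_addr _ _) Xn).
rewrite -(avg_ren _ bh) avg_catC in cD.
pose Q (v : T) (y : {ffun 'I_n -> A}) := [exists t, v t == None] &&
  [forall a, D (ren_word h (cat_word (line_pt v a) y))].
have [|||v Qv] := @avg_pigeonhole R _ T _ Q c _ c0 _ cD.
- exact: card_word_gt0.
- by move=> y; exact: avg_bool_le1.
- move=> y /Hn1[|v [[t vt] vD]]; first by rewrite card_ord.
  exists v; apply/andP; split; last by apply/forallP.
  by apply/existsP; exists t; rewrite vt.
have [|u ou uQ] := Hn2 _ _ _ Qv.
  by rewrite card_ord nE card_ord leq_subRL ?(leq_trans (leq_addr _ _) Xn).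
exists (ren_pat h [ffun t => match t with
  | inl t => if v t is Some a then inl a else inr ord0
  | inr t => match u t with inl a => inl a | inr i => inr (lift ord0 i) end end]).
  apply: onto_ren => // i; case: (unliftP ord0 i) => [j ->|->].
    by have [t ut] := ou j; exists (inr t); rewrite ffunE ut.
  have [y _] : exists y : {ffun 'I_m -> A}, true.
    by have /card_gt0P[y _] := card_word_gt0 'I_m A0; exists y.
  have /andP[/existsP[t /eqP vt] _] := uQ y.
  by exists (inl t); rewrite ffunE vt.
move=> x; have /andP[_ /forallP/(_ (x ord0))] := uQ [ffun i => x (lift ord0 i)].
rewrite fill_ren; congr (D (ren_word _ _)); apply/ffunP => -[t|t]; rewrite !ffunE.
  by case: (v t).
by case: (u t) => // i; rewrite ffunE.
Qed.

End Lines.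

Lemma dhj_bij (R : realType) (A A' : finType) (h : A -> A') (c : R) :
  bijective h -> dhj A' c -> dhj A c.
Proof.
move=> [g hK gK] [n Hn]; exists n => X Xn D.
have bg : bijective (fun x : {ffun X -> A'} => [ffun t => g (x t)] : {ffun X -> A}).
  exists (fun x : {ffun X -> A} => [ffun t => h (x t)]) => x;
    by apply/ffunP => t; rewrite !ffunE (gK, hK).
rewrite -(avg_reindex _ bg) => /Hn -/(_ Xn)[v [[t vt] vD]].
exists [ffun t => omap g (v t)]; split; first by exists t; rewrite ffunE vt.
move=> a; move: (vD (h a)); congr D; apply/ffunP => s; rewrite !ffunE.
by case: (v s) => //=; rewrite hK.
Qed.

(** * Sets insensitive to exchanging the new letter with an old one *)

Section Insensitive.
Variable B : finType.
Local Notation A := (option B).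
Implicit Types X Y : finType.

(* The new letter [None] is replaced by [Some b]. *)
Definition erase X (b : B) (x : {ffun X -> A}) : {ffun X -> A} :=
  [ffun t => Some (odflt b (x t))].

Lemma eraseE X b (x : {ffun X -> A}) : erase b x = map_word Some (line_pt x b).
Proof. by apply/ffunP => t; rewrite !ffunE. Qed.

Lemma erase_id X b (x : {ffun X -> A}) : erase b (erase b x) = erase b x.
Proof. by apply/ffunP => t; rewrite !ffunE. Qed.

Lemma erase_fill X Y b (u : {ffun X -> A + Y}) x :
  erase b (fill u (erase b x)) = erase b (fill u x).
Proof.
by apply/ffunP => t; rewrite !ffunE; case: (u t) => // y; rewrite ffunE.
Qed.

Lemma erase_cat X Y b (x : {ffun X -> A}) (y : {ffun Y -> A}) :
  erase b (cat_word x y) = cat_word (erase b x) (erase b y).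
Proof. by apply/ffunP => -[t|t]; rewrite !ffunE. Qed.

(** Membership depends on the erasure alone; words that differ by exchanging [None] and [Some b] at
    some places have the same erasure. *)
Definition insensitive X b (S : {ffun X -> A} -> bool) :=
  forall x, S (erase b x) = S x.

Lemma insensitive_fill X Y b (S : {ffun X -> A} -> bool) (u : {ffun X -> A + Y}) :
  insensitive b S -> insensitive b (fun x => S (fill u x)).
Proof. by move=> iS x; rewrite -iS erase_fill iS. Qed.

Lemma insensitive_catr X Y b (S : {ffun X + Y -> A} -> bool) x :
  insensitive b S -> insensitive b (fun y => S (cat_word x y)).
Proof. by move=> iS y; rewrite -iS erase_cat erase_id -erase_cat iS. Qed.

Lemma insensitive_catl X Y b (S : {ffun X + Y -> A} -> bool) y :
  insensitive b S -> insensitive b (fun x => S (cat_word x y)).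
Proof. by move=> iS x; rewrite -iS erase_cat erase_id -erase_cat iS. Qed.

Variable R : realType.
Hypotheses (B0 : (0 < #|B|)%N) (dhjB : forall c : R, 0 < c -> dhj B c).

Let A0 : (0 < #|{: A}|)%N. Proof. by rewrite card_option. Qed.

(* By insensitivity, a subspace over the alphabet [B] contained in [S] stays
   in [S] when its wildcards take the value [None]. *)
Lemma insensitive_subspace b m (c : R) : 0 < c ->
  exists n, forall X : finType, (n <= #|X|)%N ->
  forall S : {ffun X -> A} -> bool, insensitive b S ->
    c <= avg (fun x => (S x)%:R) ->
    exists2 u : {ffun X -> A + 'I_m}, onto u & forall x, S (fill u x).
Proof.
move=> c0; have [n0 Hn0] := @dhj_mdhj B R m (c / 2) B0 dhjB ltac:(lra).
have someI : injective (@Some B) by move=> x y [].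
have /andP[q0 q1] := subcube_ratio R B0 someI.
set q := _ / _ in q0 q1.
have c20 : 0 < c / 4 / 2 ^+ n0 by rewrite !divr_gt0// exprn_gt0.
have [n Hn] := @expr_small R (1 - q / 2) _ ltac:(lra) c20.
exists n => X Xn S iS cS.
(* By [avg_le_subcubes], with error at most [c / 4], some subspace [g] of dimension [n0] keeps
   density above [c / 2] on words over [B]. *)
have [g og gS] : exists2 g : {ffun X -> A + 'I_n0}, onto g &
    c / 2 < avg (fun x => (S (fill g (map_word Some x)))%:R).
  apply: contrapT => h.
  have : avg (fun x => (S x)%:R) <= c / 2 + 2 ^+ n0 * (1 - q / 2) ^+ #|X|.
    apply: (avg_le_subcubes B0 someI) => //; first by move=> x; case: (S x).
      lra.
    by move=> g og; rewrite leNgt; apply/negP => ?; apply: h; exists g.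
  have : (1 - q / 2) ^+ #|X| <= (1 - q / 2) ^+ n.
    by rewrite ler_wiXn2l//; lra.
  move/le_trans/(_ Hn); rewrite ler_pdivlMr ?exprn_gt0// mulrC; lra.
have [|u0 ou0 u0S] := Hn0 _ _ _ (ltW gS); first by rewrite card_ord.
pose u1 : {ffun 'I_n0 -> A + 'I_m} :=
  [ffun t => match u0 t with inl a => inl (Some a) | inr i => inr i end].
have ou1 : onto u1.
  by move=> i; have [t ut] := ou0 i; exists t; rewrite ffunE ut.
exists (comp_pat g u1); first exact: onto_comp.
move=> x; rewrite -(insensitive_fill _ iS) fill_comp eraseE.
move: (u0S (line_pt x b)); congr (S (fill g _)); apply/ffunP => t.
by rewrite !ffunE; case: (u0 t) => // i; rewrite !ffunE.
Qed.

(** The first block has finitely many subspaces, so one of them serves a positive proportion of the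
    tails [y]. Both [n1] and [e] are independent of [X], as the iteration requires. *)
Lemma insensitive_tube b m (c : R) : 0 < c ->
  exists n1 (e : R), 0 < e /\ forall (X : finType)
    (S : {ffun 'I_n1 + X -> A} -> bool), insensitive b S ->
    c <= avg (fun x => (S x)%:R) ->
    exists2 u : {ffun 'I_n1 -> A + 'I_m}, onto u &
      e <= avg (fun y => [forall x, S (cat_word (fill u x) y)]%:R).
Proof.
move=> c0; have [n1 Hn1] := @insensitive_subspace b m (c / 2) ltac:(lra).
pose T := {ffun 'I_n1 -> A + 'I_m}.
have T0 : (0 < #|T|)%N by apply: card_word_gt0; rewrite card_sum addn_gt0 A0.
exists n1, (c / 4 / #|T|%:R); split; first by rewrite !divr_gt0// ltr0n.
move=> X S iS cS; rewrite avg_catC in cS.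
pose Q (u : T) (y : {ffun X -> A}) := [forall i, exists t, u t == inr i] &&
  [forall x, S (cat_word (fill u x) y)].
have e0 : 0 < c / 4 / #|T|%:R by rewrite !divr_gt0// ltr0n.
have [|||u Qu] := @avg_pigeonhole R _ T _ Q c _ c0 _ cS.
- exact: card_word_gt0.
- by move=> y; exact: avg_bool_le1.
- move=> y /Hn1[||u ou uS]; first by rewrite card_ord.
    exact: insensitive_catl.
  exists u; apply/andP; split; last by apply/forallP.
  by apply/forallP => i; have [t ut] := ou i; apply/existsP; exists t; rewrite ut.
exists u.
  have [y /andP[/forallP ou _]] := avg_gt0P (lt_le_trans e0 Qu).
  by move=> i; have /existsP[t /eqP ut] := ou i; exists t.
apply: (le_trans Qu); apply: ler_avg => y; rewrite /Q.
by case: [forall i, _] => //=; rewrite ler0n.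
Qed.

(* Iterating [insensitive_tube] on fresh blocks of coordinates exhausts [S] by
   disjoint subspaces, up to a geometrically small remainder. *)
Lemma insensitive_uniform b m (e : R) : 0 < e ->
  exists n, forall X : finType, (n <= #|X|)%N ->
  forall (g : {ffun X -> A} -> R) (c : R), (forall x, g x <= 1) -> 0 <= c ->
  (forall u : {ffun X -> A + 'I_m}, onto u -> avg (fun x => g (fill u x)) <= c) ->
  forall S : {ffun X -> A} -> bool, insensitive b S ->
    avg (fun x => g x * (S x)%:R) <= c + e.
Proof.
move=> e0; have [n1 [e1 [e10 Hn1]]] := @insensitive_tube b m (e / 2) ltac:(lra).
(* [kap] is the density of an [m]-dimensional subspace in a block of [n1] coordinates; [d] bounds
   from below the density removed in a round, capped at 1 to keep [1 - d] nonnegative. *)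
pose kap : R := #|{ffun 'I_m -> A}|%:R / #|{ffun 'I_n1 -> A}|%:R.
have kap0 : 0 < kap by rewrite divr_gt0// ltr0n card_word_gt0.
pose d := Num.min (kap * e1) 1.
have d0 : 0 < d by rewrite lt_min ltr01 mulr_gt0.
have d1 : d <= 1 by rewrite ge_min lexx orbT.
have dle : d <= kap * e1 by rewrite ge_min lexx.
(* The bound after [r] rounds of [n1] coordinates each: [c] on the covered part, [(1 - d) ^+ r] for
   the part still uncovered, and [e / 2] for sections too sparse to go on. *)
suff claim r : forall X : finType, (r * n1 <= #|X|)%N ->
    forall (g : {ffun X -> A} -> R) (c : R), (forall x, g x <= 1) -> 0 <= c ->
    (forall u : {ffun X -> A + 'I_m}, onto u -> avg (fun x => g (fill u x)) <= c) ->
    forall S : {ffun X -> A} -> bool, insensitive b S ->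
    avg (fun x => g x * (S x)%:R) <= c * avg (fun x => (S x)%:R) + e / 2
      + (1 - d) ^+ r * avg (fun x => (S x)%:R).
  have [r Hr] := @expr_small R (1 - d) (e / 2) ltac:(lra) ltac:(lra).
  exists (r * n1)%N => X Xn g c g1 c0 gc S iS.
  apply: le_trans (claim r X Xn g c g1 c0 gc S iS) _.
  have s1 := @avg_bool_le1 R _ S; have s0 := @avg_bool_ge0 R _ S.
  set s := avg _ in s1 s0 *; have : 0 <= (1 - d) ^+ r by rewrite exprn_ge0//; lra.
  nra.
have gS (X : finType) (g : {ffun X -> A} -> R) (S : {ffun X -> A} -> bool) :
    (forall x, g x <= 1) -> avg (fun x => g x * (S x)%:R) <= avg (fun x => (S x)%:R).
  by move=> g1; apply: ler_avg => x; case: (S x); rewrite ?mulr1 ?mulr0.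
elim: r => [|r IH] X Xn g c g1 c0 gc S iS.
  rewrite expr0 mul1r (le_trans (gS _ _ _ g1))// lerDr.
  have e20 : 0 <= e / 2 by lra.
  by rewrite addr_ge0// mulr_ge0// avg_bool_ge0.
have a0 : 0 <= (1 - d) ^+ r by rewrite exprn_ge0//; lra.
have [cS|/ltW cS] := leP (e / 2) (avg (fun x => (S x)%:R)); last first.
  have s0 := @avg_bool_ge0 R _ S.
  have : 0 <= (1 - d) ^+ r.+1 by rewrite exprn_ge0//; lra.
  move=> w0; rewrite (le_trans (gS _ _ S g1))// (le_trans cS)// addrAC lerDr.
  by rewrite addr_ge0// mulr_ge0.
have /split_index [n [h [nE bh]]] : (#|'I_n1| <= #|X|)%N.
  by rewrite card_ord (leq_trans _ Xn)// mulSn leq_addr.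
have nle : (r * n1 <= #|'I_n|)%N.
  rewrite card_ord nE card_ord; rewrite mulSn in Xn.
  by rewrite leq_subRL// (leq_trans _ Xn)// leq_addr.
pose S' z := S (ren_word h z); pose g' z := g (ren_word h z).
have iS' : insensitive b S'.
  move=> z; rewrite /S' -iS -[in RHS]iS; congr S.
  by apply/ffunP => t; rewrite !ffunE.
rewrite -(avg_ren _ bh) -[avg (fun x => (S x)%:R)](avg_ren _ bh).
rewrite -[avg (fun x => (S x)%:R)](avg_ren _ bh) in cS.
rewrite -/(S' _) in cS *.
have [u ou uS] := Hn1 _ S' iS' cS.
pose Y y := [forall x, S' (cat_word (fill u x) y)].
have iY : insensitive b Y.
  move=> y; apply: eq_forallb => x; exact: insensitive_catr.
pose V (z : {ffun 'I_n1 -> A}) := z \in codom (fill u).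
have VY z y : V z -> Y y -> S' (cat_word z y).
  by move=> /codomP[x ->] /forallP.
(* What is left of [S'] once the image of [fill u] times [Y] is removed. It need not be insensitive
   in [z], but its sections in [y] are, and the induction runs in each of them. *)
pose S1 z y := S' (cat_word z y) && ~~ (V z && Y y).
have SE z y : (S' (cat_word z y))%:R = (S1 z y)%:R + (V z)%:R * (Y y)%:R :> R.
  rewrite /S1; case Vz: (V z); case Yy: (Y y) => /=;
    rewrite ?andbT ?andbF ?mulr0 ?mul0r ?addr0// mulr1 add0r.
  by rewrite VY.
have avgY (f : {ffun 'I_n1 -> A} -> {ffun 'I_n -> A} -> R) :
    avg (fun z => avg (fun y => f z y * ((V z)%:R * (Y y)%:R)))
    = kap * avg (fun y => (Y y)%:R * avg (fun x => f (fill u x) y)).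
  rewrite (@eq_avg _ _ _ (fun z => (z \in codom (fill u))%:R
    * avg (fun y => (Y y)%:R * f z y))); last first.
    move=> z; rewrite -avgMl; apply: eq_avg => y.
    by rewrite mulrC -mulrA.
  rewrite avg_image; last exact: fill_inj.
  by rewrite -/kap avg_exchange; congr (_ * _); apply: eq_avg => y; rewrite avgMl.
set sY := avg (fun y => (Y y)%:R) in uS.
have densS : avg (fun z => (S' z)%:R) =
    avg (fun z => avg (fun y => (S1 z y)%:R)) + kap * sY.
  rewrite avg_cat -[X in _ + X]/(kap * avg _).
  rewrite (_ : kap * sY = avg (fun z => avg (fun y => 1 * ((V z)%:R * (Y y)%:R)))).
    rewrite -avgD; apply: eq_avg => z; rewrite -avgD; apply: eq_avg => y.
    by rewrite SE mul1r.
  rewrite avgY; congr (_ * _); apply: eq_avg => y.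
  by rewrite avg_cst ?mulr1//; exact: card_word_gt0.
(* For [y] in [Y], [u] followed by [y] is an [m]-dimensional subspace, on which [g] averages at most
   [c]. *)
have part2 : kap * avg (fun y => (Y y)%:R * avg (fun x => g' (cat_word (fill u x) y)))
    <= c * (kap * sY).
  rewrite [leRHS]mulrCA (ler_wpM2l (ltW kap0))// /sY -avgMl; apply: ler_avg => y.
  rewrite [leLHS]mulrC ler_wpM2r// (le_trans _ (gc (ren_pat h (catl_pat u y)) _))//.
    by apply: ler_avg => x; rewrite fill_ren fill_catl.
  by apply: onto_ren => //; exact: onto_catl.
have part1 z : avg (fun y => g' (cat_word z y) * (S1 z y)%:R)
    <= c * avg (fun y => (S1 z y)%:R) + e / 2
      + (1 - d) ^+ r * avg (fun y => (S1 z y)%:R).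
  apply: IH => //; first by move=> y; exact: g1.
    move=> w ow; rewrite (le_trans _ (gc (ren_pat h (catr_pat z w)) _))//.
      by apply: ler_avg => x; rewrite fill_ren fill_catr.
    by apply: onto_ren => //; exact: onto_catr.
  by move=> y; rewrite /S1 iY (insensitive_catr _ iS').
have main : avg (fun z => g' z * (S' z)%:R) <=
   avg (fun z => c * avg (fun y => (S1 z y)%:R) + e / 2
      + (1 - d) ^+ r * avg (fun y => (S1 z y)%:R)) + c * (kap * sY).
  apply: le_trans (lerD (ler_avg part1) part2).
  rewrite -(avgY (fun z y => g' (cat_word z y))) -avgD avg_cat; apply: ler_avg => z.
  by rewrite -avgD; apply: ler_avg => y; rewrite SE mulrDr.
apply: (le_trans main); rewrite !avgD !avgMl avg_cst; last exact: card_word_gt0.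
have s1 := @avg_bool_le1 R _ S'.
rewrite densS in s1 *; set s := avg _ in s1 *.
have ks : d <= kap * sY by rewrite (le_trans dle)// ler_pM2l.
rewrite exprSr; set a := (1 - d) ^+ r in a0 *; set k := kap * sY in s1 ks *.
(* The removed part has density [k >= d], hence is at least the proportion [d] of the total
   [s + k <= 1]. *)
have : 0 <= a * (k - d * (s + k)).
  rewrite mulr_ge0// subr_ge0 (le_trans _ ks)// ler_piMr//; lra.
nra.
Qed.

(* The complement of an intersection is split along the first set of the list
   that is left. *)
Lemma insensitive_union_uniform (l : seq B) m (e : R) : 0 < e ->
  exists n, forall X : finType, (n <= #|X|)%N ->
  forall g : {ffun X -> A} -> R, (forall x, g x <= 1) ->
  (forall u : {ffun X -> A + 'I_m}, onto u -> avg (fun x => g (fill u x)) <= 0) ->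
  forall C : B -> {ffun X -> A} -> bool, (forall b, insensitive b (C b)) ->
    avg (fun x => g x * (~~ all (C^~ x) l)%:R) <= e.
Proof.
elim: l m e => [|b l IH] m e e0.
  exists 0%N => X _ g _ _ C _; rewrite /avg big1 ?mul0r ?ltW// => x _.
  by rewrite mulr0.
have [nl Hl] := IH m (e / 3) ltac:(lra).
have [n1 H1] := @insensitive_uniform b m (e / 3) ltac:(lra).
(* [C b] is filled with subspaces of dimension [nl], so that the induction hypothesis applies inside
   each. *)
have [n2 H2] := @insensitive_uniform b nl (e / 3) ltac:(lra).
exists (maxn n1 n2) => X; rewrite geq_max => /andP[Xn1 Xn2] g g1 g0 C iC.
have k1 : avg (fun x => g x * (~~ C b x)%:R) <= 0 + e / 3.
  by apply: H1 => // x; rewrite iC.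
have k2 : avg (fun x => (g x * (~~ all (C^~ x) l)%:R) * (C b x)%:R)
    <= e / 3 + e / 3.
  apply: H2 => //; last 1 first.
  - move=> u ou; apply: Hl => //; first by rewrite card_ord.
      move=> w ow; rewrite (le_trans _ (g0 (comp_pat u w) _))//.
        by apply: ler_avg => x; rewrite fill_comp.
      exact: onto_comp.
    by move=> b'; exact: insensitive_fill.
  - by move=> x; case: all; rewrite /= ?mulr0 ?mulr1.
  - lra.
rewrite (@eq_avg _ _ _ (fun x => g x * (~~ C b x)%:R
   + (g x * (~~ all (C^~ x) l)%:R) * (C b x)%:R)) ?avgD; first by lra.
move=> x /=; case: (C b x); case: all => /=;
  by rewrite ?(mulr0, mulr1, addr0, add0r).
Qed.

End Insensitive.

(** * Adding one letter to the alphabet *)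

Section Step.
Variables (R : realType) (B : finType).
Local Notation A := (option B).
Hypotheses (B0 : (0 < #|B|)%N) (dhjB : forall c : R, 0 < c -> dhj B c).

Let A0 : (0 < #|{: A}|)%N. Proof. by rewrite card_option. Qed.

Definition lift_pat (X Y : finType) (u : {ffun X -> B + Y}) : {ffun X -> A + Y} :=
  [ffun t => match u t with inl b => inl (Some b) | inr y => inr y end].

Lemma erase_lift_pat (X Y : finType) (u : {ffun X -> B + Y}) b (v : {ffun Y -> A}) :
  fill (lift_pat u) (erase b v) = erase b (fill (lift_pat u) v).
Proof.
by apply/ffunP => t; rewrite !ffunE; case: (u t) => // y; rewrite ffunE.
Qed.

(* The wildcards of the line are the positions of [None] in [x]; its point at
   the letter [None] is [x] itself. *)
Lemma has_line_erase (Z X2 : finType) (D : {ffun Z + X2 -> A} -> bool)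
    (x : {ffun Z -> A}) (y : {ffun X2 -> A}) (t : Z) : x t = None ->
  D (cat_word x y) -> (forall b, D (cat_word (erase b x) y)) -> has_line D.
Proof.
move=> xt Dx Dxb.
exists [ffun s => match s with inl s => omap Some (x s) | inr s => Some (y s) end].
split; first by exists (inl t); rewrite ffunE xt.
case=> [b|].
  move: (Dxb b); congr D; apply/ffunP => -[s|s]; rewrite !ffunE//.
  by case: (x s).
move: Dx; congr D; apply/ffunP => -[s|s]; rewrite !ffunE//.
by case: (x s).
Qed.

(* A counterexample to [dhj] just below the critical density [c] has no line in
   its subspaces, hence density at most [c + e] on all large ones. *)
Lemma dhj_critical (c0 : R) : 0 < c0 -> ~ dhj A c0 ->
  exists2 c : R, 0 < c & forall e, 0 < e -> dhj A (c + e) /\ ~ dhj A (c - e).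
Proof.
move=> c00 nc0; pose S : set R := fun c => dhj A c.
have up c c' : c <= c' -> dhj A c -> dhj A c'.
  move=> cc' [n Hn]; exists n => X Xn D hD; apply: Hn => //.
  exact: le_trans hD.
have S2 : S 2.
  exists 0%N => X _ D hD; have := @avg_bool_le1 R _ D; lra.
have lb : lbound S c0.
  by move=> c Sc; rewrite leNgt; apply/negP => /ltW cc0; apply: nc0; apply: up Sc.
have hS : has_inf S by split; [exists 2 | exists c0].
exists (inf S).
  by apply: lt_le_trans c00 _; apply: lb_le_inf => //; exists 2.
move=> e e0; split.
  have [c Sc ce] := inf_adherent e0 hS.
  exact: up (ltW ce) Sc.
move=> h; have : inf S <= inf S - e by apply: ge_inf => //; exists c0.
lra.
Qed.

Lemma dhj_option (c0 : R) : 0 < c0 -> dhj A c0.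
Proof.
move=> c0_gt0; apply: contrapT => nc0.
have [c c00 crit] := dhj_critical c0_gt0 nc0.
have [m0 Hm0] := dhjB (c := c / 4) ltac:(lra).
have c2 : c <= 2.
  have [_ nc] := crit (c / 2) ltac:(lra).
  rewrite leNgt; apply/negP => c2; apply: nc.
  by exists 0%N => X _ D; have := @avg_bool_le1 R _ D; lra.
have c41 : c / 4 <= 1 by lra.
pose T := {ffun 'I_m0 -> A}.
have T0 : (0 < #|T|)%N by exact: card_word_gt0.
pose eta : R := c / 8 / #|T|%:R.
have eta0 : 0 < eta by rewrite !divr_gt0// ltr0n.
(* [eta] is the density that the pigeonhole on [v] yields below. In the end the gain exceeds
   [c * eta / 2 = 4 * e], against errors totalling [3 * e]. *)
pose e : R := c * eta / 8.
have e0 : 0 < e by rewrite divr_gt0// mulr_gt0.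
have eta1 : 8 * eta <= c.
  rewrite (_ : 8 * eta = c / #|T|%:R) ?ler_pdivrMr ?ltr0n//; last first.
    by rewrite /eta; field; rewrite pnatr_eq0 -lt0n.
  by apply: (ler_peMr (ltW c00)); rewrite ler1n.
have [[m Hm] _] := crit e e0.
have [M' HM'] := insensitive_union_uniform B0 dhjB (enum B) m e0.
(* A letter of the random pattern is a constant in [B] or a copy of a wildcard. Under [tau0 t0],
   [None] stands for the wildcard [t0], chosen later with [v t0 = None]. *)
pose S : finType := (B + 'I_m0)%type.
pose tau0 (t0 : 'I_m0) (a : A) : S := if a is Some b then inl b else inr t0.
have tauI t0 : injective (tau0 t0) by case=> [?|] [?|] //= [->].
pose q : R := #|{: A}|%:R / #|S|%:R.
have m00 : (0 < m0)%N.
  rewrite lt0n; apply/eqP => m0E.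
  have [||v [[t _] _]] := Hm0 'I_m0 _ (fun=> true); first by rewrite card_ord.
    by rewrite avg_cst; last exact: card_word_gt0.
  by case: t => t; rewrite m0E.
have /andP[q0 q1] : 0 < q <= 1.
  exact: (subcube_ratio R A0 (tauI (Ordinal m00))).
have e20 : 0 < eta / 4 / 2 ^+ M' by rewrite divr_gt0 ?exprn_gt0// divr_gt0.
have [nM HnM] := @expr_small R (1 - q / 2) _ ltac:(lra) e20.
pose Z : finType := ('I_m0 + 'I_nM)%type.
pose N : R := #|{ffun Z -> A}|%:R.
have N1 : 1 <= N by rewrite ler1n; exact: card_word_gt0.
pose e' : R := e / (2 * N).
have e'0 : 0 < e' by rewrite divr_gt0//; lra.
have [[n2 Hn2] /forallNP/(_ (#|Z| + n2)%N)] := crit e' e'0.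
move=> /existsNP[X] /not_implyP[Xn] /existsNP[D0] /not_implyP[hD0 nline0].
have /split_index [n [h [nE bh]]] := leq_trans (leq_addr n2 _) Xn.
have {nE} nn2 : (n2 <= #|'I_n|)%N.
  by rewrite card_ord nE leq_subRL// (leq_trans _ Xn)// leq_addr.
pose D (z : {ffun Z + 'I_n -> A}) := D0 (ren_word h z).
have hD : c - e' <= avg (fun z => (D z)%:R) by rewrite -(avg_ren _ bh) in hD0.
have nline : ~ has_line D.
  move=> [v [[t vt] vD]]; apply: nline0; exists [ffun s => v (h s)].
  case: bh => h' hK h'K; split; first by exists (h' t); rewrite ffunE h'K.
  by move=> a; move: (vD a); congr D0; apply/ffunP => s; rewrite !ffunE.
(* [D] has no line inside a subspace, so a dimension in which density [r] forces lines caps its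
   density there at [r]. *)
have sub (Y : finType) (u : {ffun Z + 'I_n -> A + Y}) r : onto u ->
    (forall D : {ffun Y -> A} -> bool, r <= avg (fun x => (D x)%:R) -> has_line D) ->
    avg (fun x => (D (fill u x))%:R) <= r.
  move=> ou HY; rewrite leNgt; apply/negP => /ltW /HY; apply: contra_not nline.
  exact: has_line_fill.
have Pup z : avg (fun y => (D (cat_word z y))%:R) <= c + e'.
  rewrite (@eq_avg _ _ _ (fun y => (D (fill (catr_pat z (id_pat _ _)) y))%:R)).
    by apply: sub; [apply: onto_catr; exact: onto_id | exact: Hn2].
  by move=> y; rewrite fill_catr fill_id.
(* Sections have density at most [c + e'] and average at least [c - e'], with
   [e'] small compared to their number, so none of them is sparse. *)
have Plow z : c - e <= avg (fun y => (D (cat_word z y))%:R).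
  rewrite avg_cat in hD.
  have := @avg_near_max _ _ _ (c + e') (2 * e') z Pup.
  rewrite -/N (_ : N * (2 * e') = e); last first.
    by rewrite /e'; field; lra.
  by move=> H; apply: le_trans (H _); lra.
(* [u] is a random subspace with constants in [B] and wildcards ['I_m0]; the
   prefix [v] ensures that every wildcard occurs. *)
pose U (u : {ffun 'I_nM -> S}) (v : {ffun 'I_m0 -> A}) : {ffun Z -> A} :=
  cat_word v (fill (lift_pat u) v).
have eraseU u b v : erase b (U u v) = U u (erase b v).
  by rewrite /U erase_cat erase_lift_pat.
pose Q (v : T) (p : {ffun 'I_nM -> S} * {ffun 'I_n -> A}) :=
  [exists t, v t == None] && [forall b, D (cat_word (U p.1 (erase b v)) p.2)].
pose P (p : {ffun 'I_nM -> S} * {ffun 'I_n -> A}) : R :=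
  avg (fun v : {ffun 'I_m0 -> B} => (D (cat_word (U p.1 (map_word Some v)) p.2))%:R).
have S0 : (0 < #|S|)%N by rewrite card_sum addn_gt0 B0.
(* Prefixes [U u v] with [v] over [B] may be rare among all prefixes, but [Plow] holds at every
   one. *)
have c2P : c / 2 <= avg P.
  rewrite avg_pair; apply: avg_ge => [|u]; first exact: card_word_gt0.
  rewrite /P /= avg_exchange.
  apply: avg_ge => [|v]; first exact: card_word_gt0.
  apply: le_trans (Plow _).
  rewrite /e; nra.
have [||||v Qv] := @avg_pigeonhole R _ T P Q (c / 2) _ _ _ c2P.
- by rewrite card_prod muln_gt0 !card_word_gt0.
- lra.
- by move=> p; exact: avg_bool_le1.
- move=> [u y]; rewrite /P (_ : c / 2 / 2 = c / 4); last by field.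
  move=> /Hm0[|v [[t vt] vD]]; first by rewrite card_ord.
  exists v; apply/andP; split; first by apply/existsP; exists t; rewrite vt.
  by apply/forallP => b; rewrite eraseE; exact: vD.
rewrite (_ : c / 2 / 4 / #|T|%:R = eta) in Qv; last first.
  by rewrite /eta; congr (_ / _); field.
have [t0 vt0] : exists t0, v t0 = None.
  have [p /andP[/existsP[t /eqP]]] := avg_gt0P (lt_le_trans eta0 Qv).
  by exists t.
pose f (u : {ffun 'I_nM -> S}) : R := avg (fun y => (Q v (u, y))%:R).
(* Passing to a subcube over the image of [tau0 t0] turns the random pattern into words over [A], at
   the cost of half of [eta]. *)
have [g og gf] : exists2 g : {ffun 'I_nM -> S + 'I_M'}, onto g &
    eta / 2 < avg (fun x => f (fill g (map_word (tau0 t0) x))).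
  apply: contrapT => ng; move: Qv; rewrite avg_pair -/(f _).
  have : avg f <= eta / 2 + 2 ^+ M' * (1 - q / 2) ^+ nM.
    apply: (avg_le_subcubes A0 (tauI t0)) => //; first by rewrite card_ord.
    - by move=> u; exact: avg_bool_le1.
    - lra.
    - by move=> g og; rewrite leNgt; apply/negP => ?; apply: ng; exists g.
  move: HnM; rewrite ler_pdivlMr ?exprn_gt0// mulrC => h1 h2 h3.
  have : eta <= avg f by [].
  lra.
(* [W] is the subspace of the words [U u v] in which [u] runs over a subcube. *)
pose W : {ffun Z -> A + 'I_M'} := [ffun t => match t with
  | inl i => inl (v i)
  | inr t => match g t with
             | inl (inl b) => inl (Some b)
             | inl (inr i) => inl (v i)
             | inr y => inr y end end].
have oW : onto W.
  by move=> y; have [t gt] := og y; exists (inr t); rewrite ffunE gt.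
have WE x : fill W x = U (fill g (map_word (tau0 t0) x)) v.
  apply/ffunP => -[t|t]; rewrite !ffunE//.
  case: (g t) => [[b|i]|y]//; rewrite !ffunE.
  by case: (x y) => [b|] /=.
have Wt0 x : fill W x (inl t0) = None by rewrite !ffunE.
pose C (y : {ffun 'I_n -> A}) (b : B) (x : {ffun 'I_M' -> A}) :=
  D (cat_word (erase b (fill W x)) y).
have fE x : f (fill g (map_word (tau0 t0) x))
    = avg (fun y => (all (C y ^~ x) (enum B))%:R).
  apply: eq_avg => y; congr (nat_of_bool _)%:R; rewrite /Q /C /=.
  rewrite (_ : [exists t, _]); last by apply/existsP; exists t0; rewrite vt0.
  apply/forallP/allP => [H b _|H b]; first by rewrite WE eraseU; exact: H.
  by rewrite -eraseU -WE; apply: H; rewrite mem_enum.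
(* On [W] every word has [None] at [t0], so a word of [D] with all its erasures in [D] would give a
   line. *)
have DC x y : (D (cat_word (fill W x) y))%:R
    = (D (cat_word (fill W x) y))%:R * (~~ all (C y ^~ x) (enum B))%:R :> R.
  case: (boolP (all _ _)) => [/allP CC|_]; last by rewrite mulr1.
  rewrite mulr0; case: (boolP (D _)) => // Dx; exfalso; apply: nline.
  apply: (has_line_erase (Wt0 x) Dx) => b.
  by apply: CC; rewrite mem_enum.
(* [D - (c + e)] averages at most 0 on [m]-dimensional subspaces, hence contributes at most [e] on
   the complement of the intersection of the [C y b]. *)
have key y : avg (fun x => ((D (cat_word (fill W x) y))%:R - (c + e))
    * (~~ all (C y ^~ x) (enum B))%:R) <= e.
  apply: HM'; first by rewrite card_ord.
  - by move=> x; case: (D _) => /=; lra.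
  - move=> u ou; rewrite avgB avg_cst ?subr_le0; last exact: card_word_gt0.
    rewrite (@eq_avg _ _ _ (fun x => (D (fill (catl_pat (comp_pat W u) y) x))%:R)).
      apply: sub; first by apply: onto_catl; exact: onto_comp.
      by apply: Hm; rewrite card_ord.
    by move=> x; rewrite fill_catl fill_comp.
  - by move=> b x; rewrite /C erase_fill.
have := @avg_le R _ _ e (card_word_gt0 'I_n A0) key.
rewrite avg_exchange.
have : avg (fun x => avg (fun y => (D (cat_word (fill W x) y))%:R)) -
    (c + e) * (1 - avg (fun x => f (fill g (map_word (tau0 t0) x)))) <=
  avg (fun x => avg (fun y => ((D (cat_word (fill W x) y))%:R - (c + e))
    * (~~ all (C y ^~ x) (enum B))%:R)).
  rewrite -[X in X - avg _](@avg_cst R {ffun 'I_M' -> A} 1);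
    last exact: card_word_gt0.
  rewrite -avgB -avgMl -avgB; apply: ler_avg => x.
  rewrite fE -[X in X - avg _](@avg_cst R {ffun 'I_n -> A} 1);
    last exact: card_word_gt0.
  rewrite -avgB -avgMl -avgB; apply: ler_avg => y.
  rewrite mulrBl -DC; case: (all _ _) => /=; lra.
have : c - e <= avg (fun x => avg (fun y => (D (cat_word (fill W x) y))%:R)).
  by apply: avg_ge => [|x]; [exact: card_word_gt0 | exact: Plow].
set a1 := avg _; set a2 := avg _ in gf *; set a3 := avg _ => h1 h2 h3.
have eE : 8 * e = c * eta by rewrite /e; field.
have : 0 < (c + e) * (a2 - eta / 2) by rewrite mulr_gt0//; lra.
have : 0 < e * eta by rewrite mulr_gt0.
nra.
Qed.

End Step.

(** With one letter there is a single word, and the line made of wildcards only reduces to it. *)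
Lemma dhj_unit (R : realType) (A : finType) (c : R) :
  #|A| = 1%N -> 0 < c -> dhj A c.
Proof.
move=> A1 c0; exists 1%N => X /card_gt0P[t _] D cD.
have [x Dx] := avg_gt0P (lt_le_trans c0 cD).
exists [ffun=> None]; split; first by exists t; rewrite ffunE.
move=> a; rewrite (_ : line_pt _ a = x)//; apply/ffunP => s.
by apply: (fintype_le1P _ _); rewrite A1.
Qed.

Theorem density_hales_jewett (R : realType) (A : finType) (c : R) :
  (0 < #|A|)%N -> 0 < c -> dhj A c.
Proof.
case An : #|A| => [//|n] _; elim: n A c An => [|n IH] A c An c0.
  exact: dhj_unit.
have [h bh] := option_index An; apply: dhj_bij bh _.
apply: dhj_option => //; first by rewrite card_ord.
by move=> c' c'0; apply: IH; rewrite ?card_ord.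
Qed.

(** * Strongly stationary laws *)

Section Laws.
Context (R : realType) (d : measure_display) (K : measurableType d) (k : nat).
Variables (mu : probability (KW k K) R) (hmu : strongly_stationary mu).

Definition letter (a : 'I_k) : word k := exist _ [:: a] isT.

Definition app_word (p : 'I_k -> word k) (v : word k) : word k :=
  match v with
  | exist (a :: s) _ => insubd (p a) (val (p a) ++ s)
  | exist [::] v0 => exist _ [::] v0
  end.

(* Past its first wildcard set, the extension has single wildcards and no
   fixed letters, so that it maps [a :: s] to [p a ++ s]. *)
Lemma line_extension (p : 'I_k -> word k) : is_line p ->
  exists2 phi, is_inf_subspace phi & forall a, phi (letter a) = p a.
Proof.
move=> [N1 [I [w [N10 IN [m0 Im0] sw Hp]]]].
have pcat a s : (0 < size (val (p a) ++ s))%N.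
  by rewrite size_cat addn_gt0 (valP (p a)).
have appE a s (h : (0 < size (a :: s))%N) :
    val (app_word p (exist _ (a :: s) h)) = val (p a) ++ s.
  by rewrite /app_word val_insubd pcat.
exists (app_word p); last first.
  by move=> a; apply: val_inj; rewrite appE cats0.
(* [a0] pads the words of fixed letters; the positions it fills are all wildcards. *)
have [a0 _] : exists a0, a0 \in w.
  case: w sw {Hp} => [sw|a0 w _]; first by rewrite -sw in N10.
  by exists a0; rewrite mem_head.
exists (fun n => if n is n'.+1 then N1 + n' else 0)%N.
exists (fun i => if i is i'.+1 then
  if i' is j.+1 then [set (N1 + j)%N] else I else set0).
exists (fun n => if n is n'.+1 then w ++ nseq n' a0 else [::]).
split; first split => //.
- by case=> [|i]; rewrite ?addn0// addnS.
- case=> [|i] m /=; first by move/IN; rewrite addn0.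
  by move=> ->; rewrite leqnn addnS ltnS leqnn.
- by case=> [|i] /=; [exists m0 | exists (N1 + i)%N].
- by case=> [|n] //; rewrite size_cat size_nseq sw.
case=> -[//|a s] h; rewrite appE /=; have [sp Ha] := Hp a.
split; first by rewrite size_cat sp.
move=> m mN; split.
  case=> [//|[|j]] /= jn.
    move=> Im; rewrite onth_cat sp; have mN1 : (m < N1)%N := IN _ Im.
    by rewrite mN1 (Ha m mN1).1.
  by move=> ->; rewrite onth_cat sp ltnNge leq_addr /= addKn.
move=> nI; have [mN1|N1m] := ltnP m N1.
  rewrite !onth_cat sp sw mN1; apply: (Ha m mN1).2.
  exact: (nI 1%N).
exfalso; apply: (nI (m - N1).+2) => /=; last by rewrite subnKC.
by rewrite !ltnS -(ltn_add2l N1) subnKC.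
Qed.

Lemma measurable_coord (w : word k) (B : set K) : measurable B ->
  measurable [set x : KW k K | B (x w)].
Proof.
move=> mB; apply: sub_sigma_algebra; exists w => //; exists B => //.
by rewrite setTI.
Qed.

Lemma measurable_points (p : 'I_k -> word k) (A : 'I_k -> set K) :
  (forall a, measurable (A a)) ->
  measurable [set x : KW k K | forall a, A a (x (p a))].
Proof.
move=> mA.
rewrite (_ : mkset _ = \bigcap_(a in [set: 'I_k]) [set x : KW k K | A a (x (p a))]).
  by apply: fin_bigcap_measurable => // a _; exact: measurable_coord.
by apply/seteqP; split => x h a => [_|]; exact: h.
Qed.

(** Every line is the image of the one-letter words under an infinite-dimensional subspace, so these
    serve as the reference line. *)
Lemma line_marginalE (p : 'I_k -> word k) (A : 'I_k -> set K) :
  is_line p -> (forall a, measurable (A a)) ->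
  line_marginal mu p A = line_marginal mu letter A.
Proof.
move=> /line_extension[phi iphi phiE] mA.
rewrite /line_marginal -[RHS](hmu iphi); last exact: measurable_points.
congr (mu _); apply/seteqP; split => x /= h a; move: (h a);
  by rewrite /Tphi phiE.
Qed.

Lemma point_marginal_line (p : 'I_k -> word k) a (B : set K) :
  is_line p -> measurable B ->
  point_marginal mu (p a) B = point_marginal mu (letter a) B.
Proof.
move=> /line_extension[phi iphi phiE] mB.
rewrite /point_marginal -[RHS](hmu iphi); last exact: measurable_coord.
by congr (mu _); apply/seteqP; split => x /=; rewrite /Tphi phiE.
Qed.

Lemma point_marginal_cons a s h (B : set K) : measurable B ->
  point_marginal mu (exist _ (a :: s) h) B = point_marginal mu (letter a) B.
Proof.
move=> mB; pose p b : word k := exist _ (b :: s) isT.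
rewrite -(@point_marginal_line p a)//.
  by congr (point_marginal mu _ B); apply: val_inj.
exists (size s).+1, [set 0%N], (a :: s); split => //.
- by move=> m ->.
- by exists 0%N.
move=> b; split => // m mN; split => [->//|].
by case: m mN => [|m] _ // /(_ erefl).
Qed.

(** The word [[:: a; b]] links two letters: its first letter gives it the law at [a], and the line
    with its wildcard in second place gives it the law at [b]. *)
Lemma point_marginalE (w w' : word k) (B : set K) : measurable B ->
  point_marginal mu w B = point_marginal mu w' B.
Proof.
move=> mB; case: w => -[//|a s] h; case: w' => -[//|b s'] h'.
rewrite !point_marginal_cons//.
pose p c : word k := exist _ [:: a; c] isT.
rewrite -(@point_marginal_line p b)//; first by rewrite point_marginal_cons.
exists 2%N, [set 1%N], [:: a; a]; split => //.
- by move=> m ->.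
- by exists 1%N.
by move=> c; split => // m mN; split => [->//|];
  case: m mN => [|[|m]] // _ /(_ erefl).
Qed.

End Laws.

(** * Words as finite functions, and the conclusion *)

Definition ffun_word k n (z : {ffun 'I_n.+1 -> 'I_k}) : word k :=
  insubd (exist _ [:: z ord0] isT) (codom z).

Lemma val_ffun_word k n (z : {ffun 'I_n.+1 -> 'I_k}) : val (ffun_word z) = codom z.
Proof. by rewrite val_insubd size_codom card_ord. Qed.

Lemma onth_codom k n (z : {ffun 'I_n.+1 -> 'I_k}) m (h : (m < n.+1)%N) :
  onth (codom z) m = Some (z (Ordinal h)).
Proof.
rewrite /codom /image_mem onth_map.
rewrite (_ : onth _ m = Some (Ordinal h))//.
rewrite onthE (nth_map ord0) ?size_enum_ord//; congr Some; apply: val_inj.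
by rewrite /= nth_enum_ord.
Qed.

(** The points of a line agree off the wildcards, so the point at [a0] serves as the word of fixed
    letters. *)
Lemma line_pt_is_line k n (v : {ffun 'I_n.+1 -> option 'I_k}) (a0 : 'I_k) :
  (exists t, v t = None) -> is_line (fun a => ffun_word (line_pt v a)).
Proof.
move=> [t vt]; exists n.+1.
exists (fun m => exists h : (m < n.+1)%N, v (Ordinal h) = None).
exists (codom (line_pt v a0)); split => //.
- by move=> m [].
- exists (val t), (ltn_ord t); rewrite -[RHS]vt; congr (v _); exact: val_inj.
- by rewrite size_codom card_ord.
move=> a; rewrite val_ffun_word; split; first by rewrite size_codom card_ord.
move=> m mn; rewrite !onth_codom !ffunE; split.
  by move=> [h]; rewrite (bool_irrelevance mn h) => ->.
by case E : (v _) => // nv; exfalso; apply: nv; exists mn.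
Qed.

Theorem theorem5p3 (R : realType) (d : measure_display) (K : measurableType d)
  (k : nat) (hk : (0 < k)%N) (hK : standard_borel K R)
  (mu : probability (KW k K) R) (hmu : strongly_stationary mu)
  (A : 'I_k -> set K) (hA : forall a, measurable (A a))
  (p : 'I_k -> word k) (hp : is_line p) (w : word k) :
  line_marginal mu p A = 0%E ->
  point_marginal mu w (\bigcap_(a in [set: 'I_k]) A a) = 0%E.
Proof.
move=> line0; set B := \bigcap_(a in _) A a.
have mB : measurable B by exact: fin_bigcap_measurable.
apply: contrapT => /eqP pt_neq0.
pose c : R := fine (point_marginal mu w B).
have cE : point_marginal mu w B = c%:E.
  by rewrite /c fineK// fin_num_measure//; exact: measurable_coord.
have c0 : 0 < c by rewrite -lte_fin -cE lt0e pt_neq0 measure_ge0.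
have [n Hn] := @density_hales_jewett R 'I_k (c / 2)
  ltac:(by rewrite card_ord) ltac:(lra).
pose W := {ffun 'I_n.+1 -> 'I_k}.
have W0 : (0 < #|W|)%N by apply: card_word_gt0; rewrite card_ord.
pose L (v : {ffun 'I_n.+1 -> option 'I_k}) : set (KW k K) :=
  [set x : KW k K | forall a, B (x (ffun_word (line_pt v a)))].
(* There are finitely many lines, and each has all its values in [B] with probability 0, because [B]
   lies in every [A a]. *)
pose N : set (KW k K) :=
  \big[setU/set0]_(v : {ffun 'I_n.+1 -> option 'I_k} | [exists t, v t == None]) L v.
have [mN N0] : measurable N /\ mu N = 0%E.
  rewrite /N; apply: (big_ind (fun E : set (KW k K) => measurable E /\ mu E = 0%E)).
  - by split; [exact: measurable0 | exact: measure0].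
  - by move=> E F [mE E0] [mF F0]; split; [exact: measurableU | rewrite measureU0].
  move=> v /existsP[t /eqP vt].
  have mL : measurable (L v).
    exact: (@measurable_points _ K k _ (fun=> B)).
  split => //; apply/eqP; rewrite eq_le measure_ge0 andbT -line0.
  have lv : is_line (fun a => ffun_word (line_pt v a)).
    by apply: (line_pt_is_line (Ordinal hk)); exists t.
  rewrite (line_marginalE hmu hp hA) -(line_marginalE hmu lv hA).
  apply: le_measure; rewrite ?inE//; first exact: measurable_points.
  by move=> x Lx a; exact: Lx.
(* Removing the null set [N] keeps the measure and lets [dens] hold at every [x]. *)
pose E (z : W) : set (KW k K) := [set x : KW k K | B (x (ffun_word z))] `\` N.
have mE z : measurable (E z) by apply: measurableD => //; exact: measurable_coord.
have muE z : mu (E z) = c%:E.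
  rewrite -cE -(point_marginalE hmu (ffun_word z) w mB) /point_marginal.
  rewrite -[LHS](measureU0 (mE z) mN N0) -[RHS](measureU0 _ mN N0); last first.
    exact: measurable_coord.
  by rewrite /E setDE setUIl setUCl setIT.
(* Off [N], the words [z] with [x] in [E z] contain no line, so their density is at most [c / 2]; on
   [N] there are none. *)
have dens x : \sum_(z : W) (\1_(E z) x : R) <= c / 2 * #|W|%:R.
  rewrite -ler_pdivrMr ?ltr0n// -/(avg _) leNgt; apply/negP => h.
  have [xN|xN] := pselect (N x).
    move: h; rewrite /avg big1 ?mul0r; first by lra.
    by move=> z _; rewrite indicE memNset// => -[].
  have [||v [[t vt] vB]] := Hn 'I_n.+1 _ (fun z => x \in E z).
  - by rewrite card_ord.
  - by rewrite ltW.
  apply: xN; rewrite /N -bigcup_seq_cond.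
  exists v => /=; first by rewrite mem_index_enum; apply/existsP; exists t; rewrite vt.
  by move=> a; have := vB a; rewrite inE => -[].
(* Each [E z] has measure [c], so integrating [dens] gives [c <= c / 2]. *)
have : (\int[mu]_(x in setT) (\sum_(z : W) (\1_(E z) x)%:E)
    <= \int[mu]_(x in setT) (cst (c / 2 * #|W|%:R)%:E x))%E.
  apply: ge0_le_integral => //.
  - by move=> x _; apply: sume_ge0 => z _; rewrite lee_fin.
  - apply: emeasurable_sum => z; apply/measurable_EFinP; exact: measurable_indic.
  - by move=> x _; rewrite sumEFin lee_fin.
rewrite ge0_integral_sum//; last first.
  by move=> z; apply/measurable_EFinP; exact: measurable_indic.
rewrite integral_cst// [X in (_ * X)%E]probability_setT mule1.
rewrite (eq_bigr (fun=> c%:E)); last first.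
  by move=> z _; rewrite integral_indic// setIT; exact: muE.
rewrite sumEFin lee_fin sumr_const -[_ *+ _]mulr_natr ler_pM2r ?ltr0n//; lra.
Qed.
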